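(* Let $X$, $Y$ and $Y'$ be metric spaces, let $s_1, s_2, r > 0$, and let $f, g : X \to Y$ be $s_1$-Lipschitz maps. Let $\alpha : Y \to Y'$ be an $s_2$-Lipschitz map with a discrete left homotopy inverse, i.e. such that there exists a $\frac{1}{s_2}$-Lipschitz map $\beta : Y' \to Y$ with $\beta \circ \alpha \simeq_{(1,r)} \mathrm{id}_Y$. Then $$D^{(s_1)}_r(f, g) = D^{(s_1 s_2)}_{s_2 r}(\alpha \circ f, \alpha \circ g).$$
   Context: For a non-negative integer $m$, $[m] = \{0, 1, \dots, m\}$ carries the metric $d(a,b) = |a-b|$. For $s \ge 0$, a map $\varphi$ between metric spaces is $s$-Lipschitz if $d(\varphi(x), \varphi(x')) \le s\, d(x,x')$ for all $x,x'$. For maps $f, g : X \to Y$ between metric spaces, an $(s,r)$-homotopy between $f$ and $g$ is a map $F : X \times [m] \to Y$, for some non-negative integer $m$, such that (1) $F(x,-) : [m] \to Y$ is $r$-Lipschitz for every $x \in X$; (2) $F(-,i) : X \to Y$ is $s$-Lipschitz for every $i \in [m]$; (3) $F(x,0) = f(x)$ and $F(x,m) = g(x)$ for all $x \in X$. One writes $f \simeq_{(s,r)} g$ if such an $F$ exists. For two $s$-Lipschitz maps $f,g : X \to Y$, the discrete homotopic distance $D^{(s)}_r(f,g)$ is the smallest integer $k \ge 0$ for which there is an open cover $U_0, \dots, U_k$ of $X$ with $f|_{U_i} \simeq_{(s,r)} g|_{U_i}$ (as maps $U_i \to Y$) for all $i = 0, \dots, k$; it is $\infty$ if no such cover exists.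 *)

(* Defs.v *)
From HB Require Import structures.
From mathcomp Require Import all_boot all_order all_algebra.
From mathcomp Require Import all_classical all_reals all_analysis.

Set Implicit Arguments.
Unset Strict Implicit.
Unset Printing Implicit Defensive.

Import Order.TTheory GRing.Theory Num.Theory.

Local Open Scope classical_set_scope.
Local Open Scope ring_scope.

(* The library already gives [set_type A] the induced pseudometric. *)
Section SubspaceMetric.
Context {R : realType} {X : metricType R} (A : set X).

Let sub_dist (x y : A) : R := mdist (set_val x) (set_val y).

Let sub_dist_ge0 x y : 0 <= sub_dist x y.
Proof. exact: mdist_ge0. Qed.

Let sub_dist_positivity x y : sub_dist x y = 0 -> x = y.
Proof. by move/mdist_positivity => xy; apply: val_inj. Qed.

Let sub_ballEdist (x : A) (e : R) : ball x e = [set y | sub_dist x y < e].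
Proof. by rewrite -initial_ballE ballEmdist. Qed.

HB.instance Definition _ := @PseudoMetric_isMetric.Build R (A : Type)
  sub_dist sub_dist_ge0 sub_dist_positivity sub_ballEdist.

End SubspaceMetric.

(* [m] = {0, ..., m}; the unused parameter R lets the metric structure with
   values in R be inferred from the type. *)
Definition discrete_interval (R : realType) (m : nat) : Type := 'I_m.+1.

Section DiscreteIntervalMetric.
Variables (R : realType) (m : nat).
Local Notation I := (discrete_interval R m).

HB.instance Definition _ := Choice.on I.

Let dist (i j : I) : R := `|(i : nat)%:R - (j : nat)%:R|.

Let dist_xx i : dist i i = 0.
Proof. by rewrite /dist subrr normr0. Qed.

Let dist_positivity i j : dist i j = 0 -> i = j.
Proof.
by move=> /normr0_eq0/eqP; rewrite subr_eq0 eqr_nat => /eqP/val_inj.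
Qed.

Let dist_sym i j : dist i j = dist j i.
Proof. exact: distrC. Qed.

Let dist_triangle j i k : dist i k <= dist i j + dist j k.
Proof. exact: ler_distD. Qed.

HB.instance Definition _ :=
  isMetric.Build R I dist_xx dist_positivity dist_sym dist_triangle.

End DiscreteIntervalMetric.

Section DiscreteHomotopy.
Context {R : realType}.

(* The library's [k.-lipschitz] is restricted to normed modules. *)
Definition is_lipschitz {X Y : metricType R} (s : R) (f : X -> Y) : Prop :=
  forall x x' : X, mdist (f x) (f x') <= s * mdist x x'.

Definition is_homotopy {X Y : metricType R} (s r : R) (f g : X -> Y)
    (m : nat) (F : X -> discrete_interval R m -> Y) : Prop :=
  [/\ forall x, is_lipschitz r (F x),
      forall i, is_lipschitz s (F ^~ i),
      forall x, F x ord0 = f x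
    & forall x, F x ord_max = g x].

Definition homotopic {X Y : metricType R} (s r : R) (f g : X -> Y) : Prop :=
  exists (m : nat) (F : X -> discrete_interval R m -> Y),
    is_homotopy s r f g F.

Definition has_homotopy_cover {X Y : metricType R} (s r : R) (f g : X -> Y)
    (k : nat) : Prop :=
  exists U : 'I_k.+1 -> set X,
    [/\ forall i, open (U i),
        \bigcup_i U i = [set: X]
      & forall i, homotopic s r (fun x : U i => f (set_val x))
                                (fun x : U i => g (set_val x))].

Definition discrete_homotopic_distance {X Y : metricType R} (s r : R)
    (f g : X -> Y) : \bar R :=
  match pselect (exists k, `[< has_homotopy_cover s r f g k >]) with
  | left ex_k => (ex_minn ex_k)%:R%:E
  | right _ => +oo%E
  end.

End DiscreteHomotopy.

(* Main.v *)
Require Import Defs.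
From HB Require Import structures.
From mathcomp Require Import all_boot all_order all_algebra.
From mathcomp Require Import all_classical all_reals all_analysis.

Set Implicit Arguments.
Unset Strict Implicit.
Unset Printing Implicit Defensive.

Import Order.TTheory GRing.Theory Num.Theory.

Local Open Scope classical_set_scope.
Local Open Scope ring_scope.

(** A cover of [X] witnesses one distance exactly when it witnesses the other,
so the two minima agree. Composing a homotopy on a piece [U] with [alpha]
multiplies both Lipschitz constants by [s2], which turns a homotopy
[f ~ g] into one [alpha f ~ alpha g] (lemma [homotopic_comp_left]).
Conversely, composing with [beta] divides them by [s2] and gives
[beta alpha f ~ beta alpha g] with the original constants. The homotopy
[beta alpha ~ id] precomposed with the [s1]-Lipschitz maps [f] and [g]
([homotopic_comp_right]) links the ends of this homotopy to [f] and [g],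
again with constants [(s1, r)], so that symmetry and transitivity
of [(s1, r)]-homotopy conclude:
[f ~ beta alpha f ~ beta alpha g ~ g].

Symmetry and transitivity are obtained by viewing a homotopy as a finite
chain of [s]-Lipschitz maps whose consecutive members are uniformly at
distance at most [r] ([homotopicP]): chains can be reversed and concatenated,
and since only consecutive times are compared, no special estimate is needed
for pairs of times lying on both sides of the junction. *)

Section Lipschitz.
Context {R : realType}.

Lemma is_lipschitz_comp {X Y Z : metricType R} (s t : R)
    (h : Y -> Z) (f : X -> Y) : 0 <= t ->
  is_lipschitz t h -> is_lipschitz s f -> is_lipschitz (t * s) (h \o f).
Proof.
move=> t0 hh hf x x' /=; apply: le_trans (hh _ _) _.
by rewrite -mulrA; apply: ler_wpM2l => //; exact: hf.
Qed.

Lemma is_lipschitz_restrict {X Y : metricType R} (s : R) (f : X -> Y)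
    (U : set X) : is_lipschitz s f -> is_lipschitz s (fun x : U => f (set_val x)).
Proof. by move=> hf x x'; exact: hf. Qed.

End Lipschitz.

Section Homotopy.
Context {R : realType}.

(** Time runs over all of [nat] rather than over ['I_m.+1], so that reversal and
concatenation are plain arithmetic on indices. *)
Definition is_chain {X Y : metricType R} (s r : R) (f g : X -> Y)
    (m : nat) (F : nat -> X -> Y) : Prop :=
  [/\ forall i x, (i < m)%N -> mdist (F i x) (F i.+1 x) <= r,
      forall i, (i <= m)%N -> is_lipschitz s (F i),
      F 0%N =1 f
    & F m =1 g].

(** The triangle inequality along the [k] unit steps from [i] to [i + k]; this
is why Lipschitz continuity on a discrete interval is a condition on
consecutive points only. *)
Lemma mdist_path_le {Y : metricType R} (r : R) (m : nat) (u : nat -> Y) :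
  (forall i, (i < m)%N -> mdist (u i) (u i.+1) <= r) ->
  forall i k, (i + k <= m)%N -> mdist (u i) (u (i + k)%N) <= r * k%:R.
Proof.
move=> step i; elim=> [|k IHk] lt_m; first by rewrite addn0 mdistxx mulr0.
rewrite addnS in lt_m *; apply: le_trans (metric_triangle _ (u (i + k)%N) _) _.
rewrite -natr1 mulrDr mulr1; apply: lerD; last exact: step.
by apply: IHk; exact: ltnW.
Qed.

Lemma homotopicP {X Y : metricType R} (s r : R) (f g : X -> Y) :
  homotopic s r f g <-> exists m F, is_chain s r f g m F.
Proof.
split=> [[m [F [Fr Fs F0 Fm]]]|[m [F [Fr Fs F0 Fm]]]].
  exists m, (fun i x => F x (inord i)); split=> [i x lt_im|i le_im|x|x].
  - apply: le_trans (Fr x _ _) _; rewrite /mdist/= !inordK//; last exact: ltnW.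
    by rewrite -natr1 opprD addrA subrr sub0r normrN1 mulr1.
  - exact: Fs.
  - by rewrite -F0; congr (F x _); apply: val_inj; rewrite /= inordK.
  - by rewrite -Fm; congr (F x _); apply: val_inj; rewrite /= inordK.
exists m, (fun x i => F (i : 'I_m.+1) x); split=> // [x|i]; last first.
  by apply: Fs; rewrite -ltnS.
have le_dist (i j : 'I_m.+1) : (i <= j)%N ->
    mdist (F i x) (F j x) <= r * `|(i : nat)%:R - (j : nat)%:R|.
  move=> le_ij; rewrite distrC -natrB// normr_nat -{1}(subnKC le_ij).
  apply: (@mdist_path_le _ _ m (F ^~ x)) => [k|]; first exact: Fr.
  by rewrite subnKC// -ltnS.
move=> i j; case/orP: (leq_total (i : 'I_m.+1) (j : 'I_m.+1)) => [|le_ji].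
  exact: le_dist.
by rewrite metric_sym [X in _ <= _ * X]metric_sym; exact: le_dist.
Qed.

Lemma homotopic_sym {X Y : metricType R} (s r : R) (f g : X -> Y) :
  homotopic s r f g -> homotopic s r g f.
Proof.
move=> /homotopicP[m [F [Fr Fs F0 Fm]]]; apply/homotopicP.
exists m, (fun i => F (m - i)%N); split=> [i x lt_im|i _|x|x].
- by rewrite metric_sym -(subnSK lt_im); apply: Fr; rewrite subnSK// leq_subr.
- by apply: Fs; exact: leq_subr.
- by rewrite subn0 Fm.
- by rewrite subnn F0.
Qed.

Lemma homotopic_trans {X Y : metricType R} (s r : R) (f g h : X -> Y) :
  homotopic s r f g -> homotopic s r g h -> homotopic s r f h.
Proof.
move=> /homotopicP[m [F [Fr Fs F0 Fm]]] /homotopicP[n [G [Gr Gs G0 Gn]]].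
apply/homotopicP.
exists (m + n)%N, (fun i => if (i < m)%N then F i else G (i - m)%N).
split=> [i x lt_i|i le_i|x|x].
- case: (ltngtP i.+1 m) => [lt_im|lt_mi|eq_im].
  + by apply: Fr; exact: ltnW.
  + by rewrite subSn//; apply: Gr; rewrite ltn_subLR.
  (* At the junction [G 0] and [F m] both equal [g]. *)
  + by rewrite eq_im subnn G0 -Fm -eq_im; apply: Fr; rewrite -eq_im.
- case: ltnP => [lt_im|le_mi]; first by apply: Fs; exact: ltnW.
  by apply: Gs; rewrite leq_subLR.
- case: posnP => [m0|_]; last exact: F0.
  by rewrite sub0n G0 -Fm m0 F0.
- by rewrite ltnNge leq_addr/= addKn Gn.
Qed.

Lemma homotopic_comp_left {X Y Z : metricType R} (s r t : R)
    (h : Y -> Z) (f g : X -> Y) : 0 <= t ->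
  is_lipschitz t h -> homotopic s r f g ->
  homotopic (t * s) (t * r) (h \o f) (h \o g).
Proof.
move=> t0 hh [m [F [Fr Fs F0 Fm]]].
exists m, (fun x => h \o F x); split=> [x|i|x|x] /=.
- exact: is_lipschitz_comp.
- exact: is_lipschitz_comp (Fs i).
- by rewrite F0.
- by rewrite Fm.
Qed.

Lemma homotopic_comp_right {X Y Z : metricType R} (s r t : R)
    (f g : Y -> Z) (h : X -> Y) : 0 <= s ->
  is_lipschitz t h -> homotopic s r f g ->
  homotopic (s * t) r (f \o h) (g \o h).
Proof.
move=> s0 hh [m [F [Fr Fs F0 Fm]]].
exists m, (F \o h); split=> [x|i|x|x] /=.
- exact: Fr.
- exact: is_lipschitz_comp (Fs i) hh.
- exact: F0.
- exact: Fm.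
Qed.

(** In [f ~ beta alpha f ~ beta alpha g ~ g] the outer homotopies have constants
[(1 * s1, r)], and the middle one has [(s1 * s2 / s2, s2 * r / s2)], so all three
compose as [(s1, r)]-homotopies. *)
Lemma homotopic_of_comp {X Y Y' : metricType R} (s1 s2 r : R) (f g : X -> Y)
    (alpha : Y -> Y') (beta : Y' -> Y) : 0 < s2 ->
  is_lipschitz s1 f -> is_lipschitz s1 g ->
  is_lipschitz (1 / s2) beta -> homotopic 1 r (beta \o alpha) idfun ->
  homotopic (s1 * s2) (s2 * r) (alpha \o f) (alpha \o g) ->
  homotopic s1 r f g.
Proof.
move=> s2_gt0 f_lip g_lip beta_lip ba_id af_ag.
have s2_neq0 : s2 != 0 by rewrite gt_eqF.
have baK (h : X -> Y) : is_lipschitz s1 h ->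
    homotopic s1 r (beta \o (alpha \o h)) h.
  by move=> h_lip; have := homotopic_comp_right ler01 h_lip ba_id; rewrite mul1r.
apply: homotopic_trans (homotopic_sym (baK f f_lip)) _.
apply: homotopic_trans (baK g g_lip).
have inv_ge0 : 0 <= 1 / s2 by rewrite div1r invr_ge0 ltW.
have := homotopic_comp_left inv_ge0 beta_lip af_ag.
by rewrite div1r mulKf// mulrCA mulVf// mulr1.
Qed.

Lemma eq_discrete_homotopic_distance {X Y Z : metricType R} (s r s' r' : R)
    (f g : X -> Y) (f' g' : X -> Z) :
  (forall k, has_homotopy_cover s r f g k <-> has_homotopy_cover s' r' f' g' k) ->
  discrete_homotopic_distance s r f g = discrete_homotopic_distance s' r' f' g'.
Proof.
move=> eq_cover; rewrite /discrete_homotopic_distance.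
case: pselect => [ex1|nex1]; case: pselect => [ex2|nex2] //.
- by congr (_%:R%:E); apply: eq_ex_minn => k; exact: asbool_equiv_eq.
- by case: nex2; case: ex1 => k /asboolP/eq_cover ck; exists k; apply/asboolP.
- by case: nex1; case: ex2 => k /asboolP/eq_cover ck; exists k; apply/asboolP.
Qed.

End Homotopy.

Theorem proposition5p1 (R : realType) (X Y Y' : metricType R)
    (s1 s2 r : R) (s1_gt0 : 0 < s1) (s2_gt0 : 0 < s2) (r_gt0 : 0 < r)
    (f g : X -> Y) (f_lip : is_lipschitz s1 f) (g_lip : is_lipschitz s1 g)
    (alpha : Y -> Y') (alpha_lip : is_lipschitz s2 alpha)
    (alpha_linv : exists beta : Y' -> Y,
        is_lipschitz (1 / s2) beta /\ homotopic 1 r (beta \o alpha) idfun) :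
  discrete_homotopic_distance s1 r f g =
  discrete_homotopic_distance (s1 * s2) (s2 * r) (alpha \o f) (alpha \o g).
Proof.
case: alpha_linv => beta [beta_lip ba_id].
apply: eq_discrete_homotopic_distance => k.
split=> -[U [U_open U_cover U_homotopic]]; exists U; split=> // i.
  rewrite mulrC; exact: homotopic_comp_left (ltW s2_gt0) alpha_lip _.
apply: (homotopic_of_comp s2_gt0 _ _ beta_lip ba_id (U_homotopic i)).
  exact: is_lipschitz_restrict.
exact: is_lipschitz_restrict.
Qed.
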